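(* Let $1\le p<\infty$. Let $\boldsymbol v=(v_n)_{n\in\mathbb{N}}$ and $\boldsymbol w=(w_n)_{n\in\mathbb{N}}$ be weight sequences such that $B_{\boldsymbol v}$ and $B_{\boldsymbol w}$ are frequently hypercyclic on $\ell_p$. If $FHC(B_{\boldsymbol v})\cap FHC(B_{\boldsymbol w})\neq\emptyset$, then for every $0<\varepsilon<1$ there exist increasing sequences $(m_k),(n_k),(m'_k),(n'_k)$ of positive integers tending to infinity with $\liminf_k n_k/m_k>0$, $\limsup_k n_k/m_k<\varepsilon$, $\liminf_k n'_k/m'_k>0$, $\limsup_k n'_k/m'_k<\varepsilon$, such that \[ \sum_{l\ge1}\frac{|w_1\cdots w_{m_l}|^p}{|v_1\cdots v_{m_l}|^p|w_1\cdots w_{m_l-n_l}|^p}<\infty \quad\text{and}\quad \sum_{l\ge1}\frac{|v_1\cdots v_{m'_l}|^p}{|w_1\cdots w_{m'_l}|^p|v_1\cdots v_{m'_l-n'_l}|^p}<\infty . \]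
   Context: $\ell_p$ is the space of complex sequences $(x_n)_{n\ge0}$ with finite $\|x\|_p$, unit vectors $(e_n)_{n\ge0}$. A weight is a bounded sequence of nonzero complex numbers; $B_{\boldsymbol w}e_0=0$, $B_{\boldsymbol w}e_n=w_ne_{n-1}$; empty products equal $1$. $FHC(T)$ is the set of vectors $x$ such that for every nonempty open $U$, $\{n:T^nx\in U\}$ has positive lower density; $T$ is frequently hypercyclic if $FHC(T)\ne\emptyset$. *)

(* Defs.v *)
From Stdlib Require Import Reals ClassicalEpsilon.
From Coquelicot Require Import Coquelicot.
Open Scope R_scope.

(* real power a^p for a >= 0, with 0^p = 0 (p > 0) *)
Definition rpow (a p : R) : R :=
  if Req_EM_T a 0 then 0 else Rpower a p.

Definition is_weight (w : nat -> C) : Prop :=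
  (exists M : R, forall n, Cmod (w n) <= M) /\ (forall n, w n <> 0%C).

Definition in_lp (p : R) (x : nat -> C) : Prop :=
  ex_series (fun n => rpow (Cmod (x n)) p).

Definition lp_norm (p : R) (x : nat -> C) : R :=
  rpow (Series (fun n => rpow (Cmod (x n)) p)) (/ p).

Definition lp_dist (p : R) (x y : nat -> C) : R :=
  lp_norm p (fun n => (x n - y n)%C).

Definition lp_open (p : R) (U : (nat -> C) -> Prop) : Prop :=
  (forall x, U x -> in_lp p x) /\
  (forall y, U y -> exists eps : R, 0 < eps /\
     forall z, in_lp p z -> lp_dist p z y < eps -> U z).

(* weighted backward shift: B_w e_0 = 0, B_w e_n = w_n e_{n-1},
   i.e. (B_w x)_n = w_{n+1} x_{n+1} *)
Definition Bw (w : nat -> C) (x : nat -> C) : nat -> C :=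
  fun n => (w (S n) * x (S n))%C.

Definition indicator (P : Prop) : R :=
  if excluded_middle_informative P then 1 else 0.

Definition density_ratio (A : nat -> Prop) (N : nat) : R :=
  sum_f_R0 (fun k => indicator (A k)) N / INR (S N).

Definition pos_lower_density (A : nat -> Prop) : Prop :=
  Rbar_lt (Finite 0) (LimInf_seq (density_ratio A)).

Definition FHC (p : R) (T : (nat -> C) -> (nat -> C)) (x : nat -> C) : Prop :=
  in_lp p x /\
  forall U, lp_open p U -> (exists y, U y) ->
    pos_lower_density (fun n => U (Nat.iter n T x)).

Fixpoint wprod (w : nat -> C) (k : nat) : C :=
  match k with
  | O => 1%C
  | S k' => (wprod w k' * w (S k'))%C
  end.

Definition incr_pos_to_infty (m : nat -> nat) : Prop :=
  (forall k, (m k < m (S k))%nat) /\ (forall k, (1 <= m k)%nat) /\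
  is_lim_seq (fun k => INR (m k)) p_infty.

(* Main.v *)
(** Write [V m], [W m] for the products of the first [m] weights, and let [x] be
    frequently hypercyclic for both shifts. Visits of the [B_v]-orbit to
    [{|y_0| > 1}] give a set [A] of positive lower density with
    [1 / |V m| < |x_m|] for [m] in [A]. As [(B_w^n x)_(m-n) = W m / W (m-n) * x_m],
    the term for [(m, n)] is then at most [|(B_w^n x)_(m-n)|^p]. Pick a large [n]
    with [||B_w^n x|| < 1]: for [a > 1/eps] and a suitable constant [K], the window
    [(a n, K n]] contains at least [n] elements [m] of [A], whose terms sum to at
    most 1, so one of these terms is at most [1/n]. A lacunary choice of [n] makes
    the series converge. *)

Require Import Defs.
From Stdlib Require Import Reals.
From Coquelicot Require Import Coquelicot.
From Stdlib Require Import Lra Lia Classical ClassicalEpsilon.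
Open Scope R_scope.

(** * Real powers with the convention [0^p = 0] *)

Lemma rpow_nonneg (a p : R) : 0 <= rpow a p.
Proof.
unfold rpow; destruct (Req_EM_T a 0); [lra|].
unfold Rpower; apply Rlt_le, exp_pos.
Qed.

Lemma rpow_pos (a p : R) : 0 < a -> 0 < rpow a p.
Proof.
intros Ha; unfold rpow; destruct (Req_EM_T a 0); [lra|apply exp_pos].
Qed.

Lemma rpow_mult (a b p : R) : 0 <= a -> 0 <= b ->
  rpow (a * b) p = rpow a p * rpow b p.
Proof.
intros Ha Hb; unfold rpow.
destruct (Req_EM_T a 0) as [->|Na].
  destruct (Req_EM_T (0 * b) 0); lra.
destruct (Req_EM_T b 0) as [->|Nb].
  destruct (Req_EM_T (a * 0) 0); lra.
destruct (Req_EM_T (a * b) 0) as [E|_].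
  destruct (Rmult_integral _ _ E); lra.
symmetry; apply Rpower_mult_distr; lra.
Qed.

Lemma rpow_le (a b p : R) : 0 < p -> 0 <= a <= b -> rpow a p <= rpow b p.
Proof.
intros Hp [Ha Hab].
destruct (Req_EM_T a 0) as [->|Na].
  unfold rpow at 1; destruct (Req_EM_T 0 0); [apply rpow_nonneg|lra].
unfold rpow; destruct (Req_EM_T a 0); [lra|].
destruct (Req_EM_T b 0); [lra|].
apply Rle_Rpower_l; lra.
Qed.

Lemma rpow_lt (a b p : R) : 0 < p -> 0 <= a < b -> rpow a p < rpow b p.
Proof.
intros Hp [Ha Hab].
destruct (Req_EM_T a 0) as [->|Na].
  unfold rpow at 1; destruct (Req_EM_T 0 0); [apply rpow_pos; lra|lra].
unfold rpow; destruct (Req_EM_T a 0); [lra|].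
destruct (Req_EM_T b 0); [lra|].
apply Rlt_Rpower_l; lra.
Qed.

Lemma rpow_rpow_inv (a p : R) : 0 < p -> 0 <= a -> rpow (rpow a (/ p)) p = a.
Proof.
intros Hp Ha.
destruct (Req_EM_T a 0) as [->|Na].
  unfold rpow; destruct (Req_EM_T 0 0) as [_|]; [|lra].
  destruct (Req_EM_T 0 0); lra.
pose proof (rpow_pos a (/ p) ltac:(lra)) as Hr.
unfold rpow at 1; destruct (Req_EM_T _ 0); [lra|].
unfold rpow; destruct (Req_EM_T a 0); [lra|].
rewrite Rpower_mult, Rinv_l, Rpower_1; lra.
Qed.

Lemma rpow_1_l (p : R) : rpow 1 p = 1.
Proof.
unfold rpow; destruct (Req_EM_T 1 0); [lra|].
unfold Rpower; rewrite ln_1, Rmult_0_r; apply exp_0.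
Qed.

(** * Series with nonnegative terms *)

Lemma Series_nonneg (b : nat -> R) : ex_series b -> (forall n, 0 <= b n) -> 0 <= Series b.
Proof.
intros Eb Hb.
(* Writing zero as [0 * 0] lets [Series_scal_l] evaluate the zero series. *)
replace 0 with (Series (fun _ => 0 * 0)) by (rewrite Series_scal_l; lra).
apply Series_le; [|assumption].
intros n; specialize (Hb n); lra.
Qed.

Lemma tail_sum_le_Series (b : nat -> R) (q M : nat) :
  ex_series b -> (forall n, 0 <= b n) ->
  sum_f_R0 (fun i => b (q + i)%nat) M <= Series b.
Proof.
intros Eb Hb.
assert (H0 : forall c, ex_series c -> (forall n, 0 <= c n) -> forall N,
  sum_f_R0 c N <= Series c).
{ intros c Ec Hc N.
  rewrite (Series_incr_n c (S N)); [simpl pred|lia|assumption].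
  assert (0 <= Series (fun k => c (S N + k)%nat)); [|lra].
  apply Series_nonneg; [|intros; apply Hc].
  now apply ex_series_incr_n. }
apply Rle_trans with (Series (fun i => b (q + i)%nat)).
  apply H0; [now apply ex_series_incr_n|intros; apply Hb].
destruct q as [|q]; [apply Rle_refl|].
rewrite (Series_incr_n b (S q)); [simpl pred|lia|assumption].
pose proof (cond_pos_sum b q Hb); lra.
Qed.

Lemma term_le_Series (b : nat -> R) (q : nat) :
  ex_series b -> (forall n, 0 <= b n) -> b q <= Series b.
Proof.
intros Eb Hb.
pose proof (tail_sum_le_Series b q 0 Eb Hb) as H; simpl in H.
now rewrite Nat.add_0_r in H.
Qed.

(* A substitute for Minkowski's inequality: either [b <= s a] or [a <= b / s]. *)
Lemma rpow_add_le (a b s p : R) : 0 < p -> 0 <= a -> 0 <= b -> 0 < s ->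
  rpow (a + b) p <= rpow (1 + s) p * rpow a p + rpow (1 + / s) p * rpow b p.
Proof.
intros Hp Ha Hb Hs.
assert (Hs' := Rinv_0_lt_compat s Hs).
rewrite <- !rpow_mult by lra.
destruct (Rle_dec b (s * a)) as [H|H].
- pose proof (rpow_nonneg ((1 + / s) * b) p).
  pose proof (rpow_le (a + b) ((1 + s) * a) p Hp ltac:(lra)); lra.
- pose proof (rpow_nonneg ((1 + s) * a) p).
  assert (a <= / s * b).
  { apply Rmult_le_reg_l with s; [lra|].
    rewrite <- Rmult_assoc, Rinv_r; lra. }
  pose proof (rpow_le (a + b) ((1 + / s) * b) p Hp ltac:(lra)); lra.
Qed.

(** * Differences and norms in [l_p] *)

Lemma Cmod_sub_le (a b : C) : Cmod (a - b)%C <= Cmod a + Cmod b.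
Proof.
unfold Cminus; eapply Rle_trans; [apply Cmod_triangle|].
rewrite Cmod_opp; lra.
Qed.

Lemma Cmod_le_add (z y : C) : Cmod z <= Cmod y + Cmod (z - y)%C.
Proof.
replace z with (y + (z - y))%C at 1 by ring.
apply Cmod_triangle.
Qed.

Lemma rpow_norm_term_nonneg (p : R) (x : nat -> C) (n : nat) : 0 <= rpow (Cmod (x n)) p.
Proof. apply rpow_nonneg. Qed.

(** Only convergence is at stake, so [rpow_add_le] with [s = 1] gives a sufficient majorant. *)
Lemma in_lp_sub (p : R) (x y : nat -> C) : 0 < p -> in_lp p x -> in_lp p y ->
  in_lp p (fun n => (x n - y n)%C).
Proof.
intros Hp Hx Hy.
apply (@ex_series_le R_AbsRing R_CompleteNormedModule) with
  (b := fun n => rpow (1 + 1) p * rpow (Cmod (x n)) p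
                 + rpow (1 + / 1) p * rpow (Cmod (y n)) p).
- intros n; change (Rabs (rpow (Cmod (x n - y n)%C) p) <=
    rpow (1 + 1) p * rpow (Cmod (x n)) p + rpow (1 + / 1) p * rpow (Cmod (y n)) p).
  rewrite Rabs_pos_eq by apply rpow_nonneg.
  eapply Rle_trans; [|apply rpow_add_le; try apply Cmod_ge_0; lra].
  apply rpow_le; [assumption|split; [apply Cmod_ge_0|apply Cmod_sub_le]].
- apply (@ex_series_plus R_AbsRing R_NormedModule);
    apply (@ex_series_scal R_AbsRing R_NormedModule); assumption.
Qed.

(** Removes the [p]-th root, so that openness can be checked on the series of [p]-th powers. *)
Lemma lp_norm_lt (p eps : R) (x : nat -> C) : 0 < p -> in_lp p x ->
  lp_norm p x < eps -> Series (fun n => rpow (Cmod (x n)) p) < rpow eps p.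
Proof.
intros Hp Hx H.
rewrite <- (rpow_rpow_inv (Series _) p Hp).
- apply rpow_lt; [assumption|split; [apply rpow_nonneg|exact H]].
- apply Series_nonneg; [exact Hx|apply rpow_norm_term_nonneg].
Qed.

(** * Two nonempty open test sets: the unit ball and the vectors with large zeroth coordinate *)

Definition small_ball (p : R) (y : nat -> C) : Prop :=
  in_lp p y /\ Series (fun n => rpow (Cmod (y n)) p) < 1.

(** For [z] near [y], [rpow_add_le] bounds the series of [z] by [(1 + eta) * S0 + D * S1], where
    [S1] is the [p]-th power of the distance. First [eta] is fixed so that the first summand stays
    below 1, then the radius so that the second fits in the gap [r]. *)
Lemma small_ball_open (p : R) : 0 < p -> lp_open p (small_ball p).
Proof.
intros Hp; split; [intros x [Hx _]; exact Hx|].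
intros y [Hy Hs].
set (S0 := Series (fun n => rpow (Cmod (y n)) p)) in Hs.
assert (S0p : 0 <= S0) by (apply Series_nonneg; [exact Hy|apply rpow_norm_term_nonneg]).
assert (Hip := Rinv_0_lt_compat p Hp).
(* With this choice [1 - (1 + eta) * S0 = (1 - S0) * (2 - S0) / 2], which is positive. *)
set (eta := (1 - S0) / 2).
assert (Heta : 0 < eta) by (unfold eta; lra).
(* Solves [(1 + s)^p = 1 + eta]. *)
set (s := rpow (1 + eta) (/ p) - 1).
assert (Hs0 : 0 < s).
{ unfold s; pose proof (rpow_lt 1 (1 + eta) (/ p) Hip ltac:(lra)) as H.
  rewrite rpow_1_l in H; lra. }
assert (Hs1 : rpow (1 + s) p = 1 + eta).
{ unfold s; replace (1 + (_ - 1)) with (rpow (1 + eta) (/ p)) by ring.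
  apply rpow_rpow_inv; lra. }
assert (His := Rinv_0_lt_compat s Hs0).
set (D := rpow (1 + / s) p).
assert (HD : 0 < D) by (apply rpow_pos; lra).
set (r := 1 - (1 + eta) * S0).
assert (Hr : 0 < r) by (unfold r, eta; nra).
assert (HrD : 0 < r / D) by (apply Rdiv_lt_0_compat; assumption).
exists (rpow (r / D) (/ p)); split; [now apply rpow_pos|].
intros z Hz Hd.
assert (Hzy := in_lp_sub p z y Hp Hz Hy).
apply lp_norm_lt in Hd; [|assumption|assumption].
rewrite rpow_rpow_inv in Hd by lra.
split; [assumption|].
set (S1 := Series (fun n => rpow (Cmod (z n - y n)%C) p)) in Hd.
apply Rle_lt_trans with ((1 + eta) * S0 + D * S1).
- unfold S0, S1; rewrite <- Hs1, <- !Series_scal_l.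
  rewrite <- Series_plus;
    [|apply (@ex_series_scal R_AbsRing R_NormedModule); assumption
     |apply (@ex_series_scal R_AbsRing R_NormedModule); assumption].
  apply Series_le.
  + intros n; split; [apply rpow_nonneg|].
    eapply Rle_trans; [|apply rpow_add_le; try apply Cmod_ge_0; lra].
    apply rpow_le; [assumption|split; [apply Cmod_ge_0|apply Cmod_le_add]].
  + apply (@ex_series_plus R_AbsRing R_NormedModule);
      apply (@ex_series_scal R_AbsRing R_NormedModule); assumption.
- apply (Rmult_lt_compat_l D) in Hd; [|assumption].
  replace (D * (r / D)) with r in Hd by (field; lra).
  unfold r in Hd; lra.
Qed.

Definition large_head (p : R) (y : nat -> C) : Prop := in_lp p y /\ 1 < Cmod (y 0%nat).

(** A single coordinate of [z - y] is bounded by its norm, so the radius [|y_0| - 1] keeps [|z_0|]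
    above 1. *)
Lemma large_head_open (p : R) : 0 < p -> lp_open p (large_head p).
Proof.
intros Hp; split; [intros x [Hx _]; exact Hx|].
intros y [Hy H1].
exists (Cmod (y 0%nat) - 1); split; [lra|].
intros z Hz Hd; split; [assumption|].
assert (Hzy := in_lp_sub p z y Hp Hz Hy).
apply lp_norm_lt in Hd; [|assumption|assumption].
pose proof (term_le_Series _ 0 Hzy (rpow_norm_term_nonneg p _)) as H; cbv beta in H.
assert (Cmod (z 0%nat - y 0%nat)%C < Cmod (y 0%nat) - 1).
{ apply Rnot_le_lt; intros Hle.
  pose proof (rpow_le (Cmod (y 0%nat) - 1) (Cmod (z 0%nat - y 0%nat)%C) p Hp ltac:(lra)).
  lra. }
pose proof (Cmod_sub_le (z 0%nat) (z 0%nat - y 0%nat)%C) as Ht.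
replace (z 0%nat - (z 0%nat - y 0%nat))%C with (y 0%nat) in Ht by ring.
lra.
Qed.

Lemma in_lp_supported_at_0 (p : R) (c : C) :
  in_lp p (fun n => match n with O => c | S _ => 0%C end).
Proof.
apply (@ex_series_incr_1 R_AbsRing R_NormedModule).
(* Past index 0 every term is [0^p = 0], written here as a multiple of a convergent geometric
   series. *)
apply ex_series_ext with (fun n : nat => 0 * (/ 2) ^ n).
- intros n; rewrite Cmod_0; unfold rpow; destruct (Req_EM_T 0 0); lra.
- apply (@ex_series_scal R_AbsRing R_NormedModule), ex_series_geom.
  rewrite Rabs_pos_eq; lra.
Qed.

Lemma small_ball_nonempty (p : R) : exists y, small_ball p y.
Proof.
exists (fun n => match n with O => RtoC 0 | S _ => RtoC 0 end).
split; [apply in_lp_supported_at_0|].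
rewrite (Series_ext _ (fun _ => 0 * 0)); [rewrite Series_scal_l; lra|].
intros [|n]; rewrite Cmod_0; unfold rpow; destruct (Req_EM_T 0 0); lra.
Qed.

Lemma large_head_nonempty (p : R) : exists y, large_head p y.
Proof.
exists (fun n => match n with O => RtoC 2 | S _ => RtoC 0 end).
split; [apply in_lp_supported_at_0|].
rewrite Cmod_R, Rabs_pos_eq; lra.
Qed.

(** * Lower density and counting *)

Lemma indicator_bounds (P : Prop) : 0 <= indicator P <= 1.
Proof. unfold indicator; destruct (excluded_middle_informative P); lra. Qed.

Lemma indicator_true (P : Prop) : P -> indicator P = 1.
Proof. unfold indicator; destruct (excluded_middle_informative P); tauto. Qed.

Lemma indicator_false (P : Prop) : ~ P -> indicator P = 0.
Proof. unfold indicator; destruct (excluded_middle_informative P); tauto. Qed.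

Lemma indicator_sum_le (A : nat -> Prop) (N : nat) :
  sum_f_R0 (fun k => indicator (A k)) N <= INR (S N).
Proof.
rewrite <- (Rmult_1_l (INR (S N))), <- (sum_cte 1 N).
apply sum_Rle; intros; apply indicator_bounds.
Qed.

Lemma pos_lower_density_count (A : nat -> Prop) : pos_lower_density A ->
  exists c N0, 0 < c /\ forall N, (N0 <= N)%nat ->
    c * INR (S N) <= sum_f_R0 (fun k => indicator (A k)) N.
Proof.
unfold pos_lower_density; intros H.
assert (Hc : exists c, 0 < c /\ eventually (fun N => c < density_ratio A N)).
{ unfold LimInf_seq in H.
  destruct (ex_LimInf_seq (density_ratio A)) as [[l| |] HL]; simpl in H, HL.
  (* A finite limit [l] leaves the ratios eventually above [l - l / 2]; for an infinite one any
     positive constant works. *)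
  - exists (l / 2); split; [lra|].
    destruct (HL (mkposreal (l / 2) ltac:(lra))) as [_ [N HN]].
    exists N; intros n Hn; specialize (HN n Hn); simpl in HN; lra.
  - exists 1; split; [lra|apply HL].
  - contradiction. }
destruct Hc as (c & Hc & N0 & HN); exists c, N0; split; [assumption|].
intros N HNN; specialize (HN N HNN); unfold density_ratio in HN.
assert (0 < INR (S N)) by (apply lt_0_INR; lia).
apply (Rmult_lt_compat_r (INR (S N))) in HN; [|assumption].
unfold Rdiv in HN; rewrite Rmult_assoc, Rinv_l in HN; lra.
Qed.

(* The elements of [A] in the window [(a, N]] are counted by [1 <= t * b (m - q)]. *)
Lemma count_le (A : nat -> Prop) (b : nat -> R) (a q N : nat) (t : R) :
  ex_series b -> (forall j, 0 <= b j) -> 0 <= t -> (q <= a < N)%nat ->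
  (forall m, A m -> (a < m <= N)%nat -> 1 <= t * b (m - q)%nat) ->
  sum_f_R0 (fun k => indicator (A k)) N <= INR (S a) + t * Series b.
Proof.
intros Eb Hb Ht Ha HA.
rewrite (tech2 _ a N) by lia.
apply Rplus_le_compat; [apply indicator_sum_le|].
apply Rle_trans with (t * sum_f_R0 (fun i => b ((S a - q) + i)%nat) (N - S a)).
- rewrite scal_sum; apply sum_Rle; intros i Hi.
  rewrite (Rmult_comm _ t).
  destruct (classic (A (S a + i)%nat)) as [HAi|HAi].
  + rewrite indicator_true by assumption.
    replace (S a - q + i)%nat with (S a + i - q)%nat by lia.
    apply HA; [assumption|lia].
  + rewrite indicator_false by assumption.
    apply Rmult_le_pos; [assumption|apply Hb].
- apply Rmult_le_compat_l; [assumption|now apply tail_sum_le_Series].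
Qed.

(** A set contained in [[0, L]] has at most [L + 1] elements, while positive lower density forces a
    count growing linearly in [N]. *)
Lemma pos_lower_density_unbounded (A : nat -> Prop) (L : nat) :
  pos_lower_density A -> exists n, (L < n)%nat /\ A n.
Proof.
intros HA; destruct (pos_lower_density_count A HA) as (c & N0 & Hc & HN).
apply NNPP; intros Hno.
destruct (INR_unbounded (INR (S L) / c)) as [N1 HN1].
set (N := (N0 + N1 + L + 1)%nat).
assert (Hsum : sum_f_R0 (fun k => indicator (A k)) N <= INR (S L)).
{ rewrite (tech2 _ L N) by (unfold N; lia).
  rewrite <- (Rplus_0_r (INR (S L))).
  apply Rplus_le_compat; [apply indicator_sum_le|].
  apply Req_le; rewrite (sum_eq _ (fun _ => 0)), sum_cte; [lra|].
  intros i _; apply indicator_false; intros HAi.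
  apply Hno; exists (S L + i)%nat; split; [lia|assumption]. }
specialize (HN N ltac:(unfold N; lia)).
assert (INR N1 < INR (S N)) by (apply lt_INR; unfold N; lia).
assert (INR (S L) < c * INR (S N)); [|lra].
apply (Rmult_lt_compat_l c) in HN1; [|assumption].
replace (c * (INR (S L) / c)) with (INR (S L)) in HN1 by (field; lra).
nra.
Qed.

(** * Weight products, orbits of the shifts, and pairs with a small term *)

Lemma wprod_neq_0 (w : nat -> C) (k : nat) :
  (forall n, w n <> 0%C) -> wprod w k <> 0%C.
Proof.
intros Hw; induction k as [|k IH]; simpl.
- intros H; apply (f_equal fst) in H; simpl in H; lra.
- now apply Cmult_neq_0.
Qed.

(** The weights met by [n] shifts are those of indices [j + 1] to [j + n]; multiplying by
    [wprod w j] completes their product and avoids a division. *)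
Lemma iter_Bw (w x : nat -> C) (n j : nat) :
  (Nat.iter n (Bw w) x j * wprod w j = wprod w (j + n) * x (j + n)%nat)%C.
Proof.
revert j; induction n as [|n IH]; intros j; simpl Nat.iter.
- rewrite Nat.add_0_r; ring.
- unfold Bw at 1; rewrite <- Nat.add_succ_comm, <- IH; simpl; ring.
Qed.

(** The general term of the first series of the theorem; exchanging [v] and [w] gives that of the
    second. *)
Definition ratio_term (p : R) (v w : nat -> C) (m n : nat) : R :=
  rpow (Cmod (wprod w m)) p /
  (rpow (Cmod (wprod v m)) p * rpow (Cmod (wprod w (m - n))) p).

Lemma ratio_term_nonneg (p : R) (v w : nat -> C) (m n : nat) :
  (forall k, v k <> 0%C) -> (forall k, w k <> 0%C) -> 0 <= ratio_term p v w m n.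
Proof.
intros Hv Hw; apply Rdiv_le_0_compat; [apply rpow_nonneg|].
apply Rmult_lt_0_compat; apply rpow_pos, Cmod_gt_0, wprod_neq_0; assumption.
Qed.

Lemma ratio_term_le (p : R) (v w x : nat -> C) (m n : nat) :
  0 < p -> (forall k, v k <> 0%C) -> (forall k, w k <> 0%C) -> (n <= m)%nat ->
  1 < Cmod (Nat.iter m (Bw v) x 0%nat) ->
  ratio_term p v w m n <= rpow (Cmod (Nat.iter n (Bw w) x (m - n)%nat)) p.
Proof.
intros Hp Hv Hw Hnm Hm.
(* At [j = 0] the empty product is 1, so the zeroth coordinate of the [m]-th iterate is
   [wprod v m * x m]. *)
pose proof (iter_Bw v x m 0) as Ev; simpl in Ev; rewrite Cmult_1_r in Ev.
rewrite Ev, Cmod_mult in Hm.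
pose proof (iter_Bw w x n (m - n)) as Ew.
replace (m - n + n)%nat with m in Ew by lia.
apply (f_equal Cmod) in Ew; rewrite !Cmod_mult in Ew.
apply (f_equal (fun r => rpow r p)) in Ew.
rewrite !rpow_mult in Ew by apply Cmod_ge_0.
pose proof (rpow_le 1 _ p Hp (conj Rle_0_1 (Rlt_le _ _ Hm))) as Hm'.
rewrite rpow_1_l, rpow_mult in Hm' by apply Cmod_ge_0.
assert (HVp := rpow_pos _ p (proj1 (Cmod_gt_0 _) (wprod_neq_0 v m Hv))).
assert (HWp := rpow_pos _ p (proj1 (Cmod_gt_0 _) (wprod_neq_0 w (m - n) Hw))).
assert (HWm := rpow_pos _ p (proj1 (Cmod_gt_0 _) (wprod_neq_0 w m Hw))).
unfold ratio_term.
set (Vm := rpow (Cmod (wprod v m)) p) in *.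
set (Wm := rpow (Cmod (wprod w m)) p) in *.
set (Wn := rpow (Cmod (wprod w (m - n))) p) in *.
set (X := rpow (Cmod (x m)) p) in *.
set (Y := rpow (Cmod (Nat.iter n (Bw w) x (m - n)%nat)) p) in *.
apply Rmult_le_reg_r with (Vm * Wn); [apply Rmult_lt_0_compat; assumption|].
replace (Wm / (Vm * Wn) * (Vm * Wn)) with Wm by (field; lra).
replace (Y * (Vm * Wn)) with (Y * Wn * Vm) by ring.
(* The goal becomes [Wm <= Wm * X * Vm], which follows from [1 <= Vm * X]. *)
rewrite Ew; nra.
Qed.

(** [K] is fixed before [L], so one bound [m <= K * n] serves all pairs and later keeps [n / m] away
    from 0. If every visit [m] in the window had a term above [1 / n], there would be too few visits
    for the lower density. *)
Lemma exists_small_ratio_term (p : R) (v w x : nat -> C) (a : nat) :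
  0 < p -> (forall k, v k <> 0%C) -> (forall k, w k <> 0%C) -> (1 <= a)%nat ->
  FHC p (Bw v) x -> FHC p (Bw w) x ->
  exists K : nat, (1 <= K)%nat /\ forall L : nat, exists mn : nat * nat,
    (L < snd mn)%nat /\ (a * snd mn < fst mn <= K * snd mn)%nat /\
    ratio_term p v w (fst mn) (snd mn) <= / INR (snd mn).
Proof.
intros Hp Hv Hw Ha [_ Fv] [_ Fw].
specialize (Fv _ (large_head_open p Hp) (large_head_nonempty p)).
specialize (Fw _ (small_ball_open p Hp) (small_ball_nonempty p)).
set (A := fun n => large_head p (Nat.iter n (Bw v) x)) in Fv.
destruct (pos_lower_density_count A Fv) as (c & N0 & Hc & HN).
destruct (INR_unbounded (INR (a + 2) / c)) as [K1 HK1].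
(* [K > (a + 2) / c] makes the density bound at [K * n] exceed [(a + 2) * n], hence the count
   [a * n + 1 + n] allowed under the negated claim; [K > a] makes the window nonempty. *)
set (K := (K1 + a + 1)%nat).
exists K; split; [unfold K; lia|]; intros L.
(* Taking [n] beyond [N0] puts [K * n] in the range where the density bound holds. *)
destruct (pos_lower_density_unbounded _ (L + N0) Fw) as (n & Hn & [Hlp Hball]).
apply NNPP; intros Hno.
assert (Hn0 : 1 <= INR n) by (apply (le_INR 1); lia).
assert (Hwin : (a * n < K * n)%nat) by (unfold K; nia).
assert (Hcount : sum_f_R0 (fun k => indicator (A k)) (K * n) <=
  INR (S (a * n)) + INR n * Series (fun j => rpow (Cmod (Nat.iter n (Bw w) x j)) p)).
(* The visit [m] is charged to coordinate [m - n] of the [n]-th iterate, whose [p]-th power exceeds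
   [1 / n] under the negated claim. *)
{ apply count_le with (q := n); try assumption.
  - apply rpow_norm_term_nonneg.
  - lra.
  - split; [nia|assumption].
  - intros m [_ HAm] Hm.
    pose proof (ratio_term_le p v w x m n Hp Hv Hw ltac:(nia) HAm) as Hle.
    apply Rnot_lt_le; intros Hlt; apply Hno.
    exists (m, n); simpl; split; [lia|split; [lia|]].
    apply Rle_trans with (1 := Hle).
    apply Rmult_le_reg_l with (INR n); [lra|].
    rewrite Rinv_r; lra. }
specialize (HN (K * n)%nat ltac:(unfold K; nia)).
apply (Rmult_lt_compat_l c) in HK1; [|assumption].
replace (c * (INR (a + 2) / c)) with (INR (a + 2)) in HK1 by (field; lra).
assert (HK : INR K1 <= INR K) by (apply le_INR; unfold K; lia).
rewrite !S_INR, !mult_INR in *.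
rewrite plus_INR in HK1; simpl (INR 2) in HK1.
assert (H1 : INR a + 2 <= c * INR K) by nra.
assert (H2 : (INR a + 2) * INR n <= c * INR K * INR n) by (apply Rmult_le_compat_r; lra).
nra.
Qed.

(** * Lacunary choice of the sequences *)

Lemma strict_incr_ge (m : nat -> nat) :
  (forall k, (m k < m (S k))%nat) -> forall k, (k <= m k)%nat.
Proof.
intros H k; induction k as [|k IH]; [lia|specialize (H k); lia].
Qed.

Lemma incr_pos_to_infty_intro (m : nat -> nat) :
  (1 <= m 0)%nat -> (forall k, (m k < m (S k))%nat) -> incr_pos_to_infty m.
Proof.
intros H0 H; split; [exact H|split].
- intros [|k]; [exact H0|specialize (H k); lia].
- apply is_lim_seq_le_p_loc with INR; [|apply is_lim_seq_INR].
  exists 0%nat; intros k _; apply le_INR, strict_incr_ge, H.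
Qed.

Lemma exists_sequences (p : R) (v w x : nat -> C) (eps : R) :
  0 < p -> (forall k, v k <> 0%C) -> (forall k, w k <> 0%C) ->
  FHC p (Bw v) x -> FHC p (Bw w) x -> 0 < eps < 1 ->
  exists m n : nat -> nat,
    incr_pos_to_infty m /\ incr_pos_to_infty n /\
    Rbar_lt (Finite 0) (LimInf_seq (fun k => INR (n k) / INR (m k))) /\
    Rbar_lt (LimSup_seq (fun k => INR (n k) / INR (m k))) (Finite eps) /\
    ex_series (fun l => ratio_term p v w (m l) (n l)).
Proof.
intros Hp Hv Hw Fv Fw [He0 He1].
(* [m > a * n] will give [n / m <= 1 / a < eps]; since [1 / eps > 1], also [a >= 2]. *)
destruct (INR_unbounded (/ eps)) as [a Haeps].
assert (Hie : 1 < / eps) by (rewrite <- Rinv_1; apply Rinv_lt_contravar; lra).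
assert (Ha : (2 <= a)%nat) by (apply (INR_lt 1); simpl; lra).
destruct (exists_small_ratio_term p v w x a Hp Hv Hw ltac:(lia) Fv Fw)
  as (K & HK & Hex).
set (f := fun L => proj1_sig (constructive_indefinite_description _ (Hex L))).
assert (Hf : forall L, (L < snd (f L))%nat /\
  (a * snd (f L) < fst (f L) <= K * snd (f L))%nat /\
  ratio_term p v w (fst (f L)) (snd (f L)) <= / INR (snd (f L))).
{ intros L; exact (proj2_sig (constructive_indefinite_description _ (Hex L))). }
clearbody f.
(* Each [m] is the threshold for the next [n], so [n_(k+1) > m_k > a * n_k >= 2 * n_k]: both
   sequences increase and [n_k >= 2^k], which makes the terms geometrically small. *)
set (g := fun k => Nat.iter k (fun mn => f (fst mn)) (f 0%nat)).
assert (Hg : forall k, (fst (g k) < snd (g (S k)))%nat) by (intros k; apply Hf).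
assert (Hgw : forall k, (a * snd (g k) < fst (g k) <= K * snd (g k))%nat /\
  ratio_term p v w (fst (g k)) (snd (g k)) <= / INR (snd (g k))).
{ intros [|k]; apply Hf. }
assert (Hg0 : (1 <= snd (g 0%nat))%nat) by (destruct (Hf 0%nat); simpl; lia).
clearbody g; clear f Hf.
exists (fun k => fst (g k)), (fun k => snd (g k)).
assert (Hpow : forall k, 2 ^ k <= INR (snd (g k))).
{ induction k as [|k IH]; [apply (le_INR 1); exact Hg0|].
  assert (H : (2 * snd (g k) <= snd (g (S k)))%nat).
  { specialize (Hg k); destruct (Hgw k); nia. }
  apply le_INR in H; rewrite mult_INR in H; simpl in H |- *; lra. }
assert (Hn : forall k, 0 < INR (snd (g k))).
{ intros k; pose proof (pow_lt 2 k ltac:(lra)); specialize (Hpow k); lra. }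
assert (Hm : forall k, INR a * INR (snd (g k)) <= INR (fst (g k)) <= INR K * INR (snd (g k))).
{ intros k; rewrite <- !mult_INR; destruct (Hgw k); split; apply le_INR; lia. }
assert (Ha' : 0 < INR a) by lra.
assert (HK' : 0 < INR K) by (apply lt_0_INR; lia).
assert (Hm0 : forall k, 0 < INR (fst (g k))).
{ intros k; specialize (Hn k); specialize (Hm k); nra. }
split; [|split; [|split; [|split]]].
- apply incr_pos_to_infty_intro.
  + destruct (Hgw 0%nat); nia.
  + intros k; specialize (Hg k); destruct (Hgw (S k)); nia.
- apply incr_pos_to_infty_intro; [exact Hg0|].
  intros k; specialize (Hg k); destruct (Hgw k); nia.
- apply Rbar_lt_le_trans with (LimInf_seq (fun _ => / INR K)).
  + rewrite LimInf_seq_const; simpl; now apply Rinv_0_lt_compat.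
  + apply LimInf_le; exists 0%nat; intros k _.
    apply Rmult_le_reg_r with (INR (fst (g k)) * INR K); [now apply Rmult_lt_0_compat|].
    specialize (Hm0 k); specialize (Hm k).
    field_simplify; lra.
- apply Rbar_le_lt_trans with (LimSup_seq (fun _ => / INR a)).
  + apply LimSup_le; exists 0%nat; intros k _.
    apply Rmult_le_reg_r with (INR (fst (g k)) * INR a); [now apply Rmult_lt_0_compat|].
    specialize (Hm0 k); specialize (Hm k).
    field_simplify; lra.
  + rewrite LimSup_seq_const; simpl.
    rewrite <- (Rinv_inv eps); apply Rinv_lt_contravar; [|assumption].
    apply Rmult_lt_0_compat; lra.
- apply (@ex_series_le R_AbsRing R_CompleteNormedModule) with (b := fun k => (/ 2) ^ k).
  + intros k; change (Rabs (ratio_term p v w (fst (g k)) (snd (g k))) <= (/ 2) ^ k).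
    rewrite Rabs_pos_eq by now apply ratio_term_nonneg.
    apply Rle_trans with (1 := proj2 (Hgw k)).
    rewrite pow_inv; apply Rinv_le_contravar; [apply pow_lt; lra|apply Hpow].
  + apply ex_series_geom; rewrite Rabs_pos_eq; lra.
Qed.

Theorem theorem4p9 (p : R) (v w : nat -> C) :
  1 <= p ->
  is_weight v -> is_weight w ->
  (exists x, FHC p (Bw v) x) ->
  (exists x, FHC p (Bw w) x) ->
  (exists x, FHC p (Bw v) x /\ FHC p (Bw w) x) ->
  forall eps : R, 0 < eps < 1 ->
  exists m n m' n' : nat -> nat,
    incr_pos_to_infty m /\ incr_pos_to_infty n /\
    incr_pos_to_infty m' /\ incr_pos_to_infty n' /\
    Rbar_lt (Finite 0) (LimInf_seq (fun k => INR (n k) / INR (m k))) /\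
    Rbar_lt (LimSup_seq (fun k => INR (n k) / INR (m k))) (Finite eps) /\
    Rbar_lt (Finite 0) (LimInf_seq (fun k => INR (n' k) / INR (m' k))) /\
    Rbar_lt (LimSup_seq (fun k => INR (n' k) / INR (m' k))) (Finite eps) /\
    ex_series (fun l =>
      rpow (Cmod (wprod w (m l))) p /
      (rpow (Cmod (wprod v (m l))) p * rpow (Cmod (wprod w (m l - n l))) p)) /\
    ex_series (fun l =>
      rpow (Cmod (wprod v (m' l))) p /
      (rpow (Cmod (wprod w (m' l))) p * rpow (Cmod (wprod v (m' l - n' l))) p)).
Proof.
intros Hp [_ Hv] [_ Hw] _ _ [x [Fv Fw]] eps He.
destruct (exists_sequences p v w x eps) as (m & n & H1 & H2 & H3 & H4 & H5);
  try assumption; [lra|].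
(* The vector [x] is frequently hypercyclic for both shifts, so the roles of [v] and [w] can be
   exchanged. *)
destruct (exists_sequences p w v x eps) as (m' & n' & H1' & H2' & H3' & H4' & H5');
  try assumption; [lra|].
exists m, n, m', n'; tauto.
Qed.
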